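(* Let $\mathbb{H}$ be the skew field of quaternions and let $h\mapsto \hat h$ be an involutive automorphism of $\mathbb{H}$ (possibly the identity). Let $A\in\mathbb{H}^{m\times m}$, $B\in\mathbb{H}^{n\times n}$ and $C\in\mathbb{H}^{m\times n}$. Then the matrix equation $$X-A\widehat{X}B=C$$ has a solution $X\in\mathbb{H}^{m\times n}$ if and only if there exist nonsingular matrices $S,R\in\mathbb{H}^{(m+n)\times(m+n)}$ such that $$\begin{bmatrix} A & C\\ 0 & I_n\end{bmatrix}R=\widehat{S}\begin{bmatrix} A & 0\\ 0 & I_n\end{bmatrix}\qquad\text{and}\qquad \begin{bmatrix} I_m & 0\\ 0 & B\end{bmatrix}R=S\begin{bmatrix} I_m & 0\\ 0 & B\end{bmatrix}.$$
   Context: $\mathbb{H}$ denotes the skew field of (real Hamilton) quaternions. An involutive automorphism of $\mathbb{H}$ is a bijection $\mathbb{H}\to\mathbb{H}$, $h\mapsto\hat h$ (possibly the identity), such that $\widehat{h+k}=\hat h+\hat k$, $\widehat{hk}=\hat h\,\hat k$ and $\hat{\hat h}=h$ for all $h,k\in\mathbb{H}$. For a quaternion matrix $H=[h_{ij}]$, $\widehat{H}:=[\hat h_{ij}]$ is obtained by applying the automorphism entrywise. $\mathbb{H}^{m\times n}$ is the set of $m\times n$ matrices over $\mathbb{H}$, and $I_k$ is the $k\times k$ identity matrix. *)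

(* Defs.v *)
From HB Require Import structures.
From mathcomp Require Import all_boot all_order all_algebra.
From mathcomp Require Import reals ring.

Set Implicit Arguments.
Unset Strict Implicit.
Unset Printing Implicit Defensive.

Import Order.TTheory GRing.Theory Num.Theory.
Local Open Scope ring_scope.

(* [Quat a b c d] stands for a + b i + c j + d k. *)
Record quaternion (F : realType) : Type :=
  Quat { qre : F; qi : F; qj : F; qk : F }.

Section Quaternions.
Variable F : realType.
Implicit Types x y z : quaternion F.

Definition quat_to_prod x : F * F * F * F := (qre x, qi x, qj x, qk x).
Definition quat_of_prod (t : F * F * F * F) : quaternion F :=
  let: (a, b, c, d) := t in Quat a b c d.

Lemma quat_to_prodK : cancel quat_to_prod quat_of_prod.
Proof. by case. Qed.

HB.instance Definition _ := Choice.copy (quaternion F) (can_type quat_to_prodK).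

Lemma quat_ext x y :
  qre x = qre y -> qi x = qi y -> qj x = qj y -> qk x = qk y -> x = y.
Proof. by case: x => a b c d; case: y => a' b' c' d' /= -> -> -> ->. Qed.

Definition quat_zero : quaternion F := Quat 0 0 0 0.
Definition quat_one : quaternion F := Quat 1 0 0 0.
Definition quat_opp x : quaternion F :=
  Quat (- qre x) (- qi x) (- qj x) (- qk x).
Definition quat_add x y : quaternion F :=
  Quat (qre x + qre y) (qi x + qi y) (qj x + qj y) (qk x + qk y).

(* The bilinear product determined by i^2 = j^2 = k^2 = i j k = -1; see
   [hamilton_relations]. *)
Definition quat_mul x y : quaternion F :=
  Quat
    (qre x * qre y - qi x * qi y - qj x * qj y - qk x * qk y)
    (qre x * qi y + qi x * qre y + qj x * qk y - qk x * qj y)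
    (qre x * qj y - qi x * qk y + qj x * qre y + qk x * qi y)
    (qre x * qk y + qi x * qj y - qj x * qi y + qk x * qre y).

Fact quat_addA : associative quat_add.
Proof. by move=> x y z; apply: quat_ext; rewrite /= addrA. Qed.
Fact quat_addC : commutative quat_add.
Proof. by move=> x y; apply: quat_ext; rewrite /= addrC. Qed.
Fact quat_add0 : left_id quat_zero quat_add.
Proof. by move=> x; apply: quat_ext; rewrite /= add0r. Qed.
Fact quat_addN : left_inverse quat_zero quat_opp quat_add.
Proof. by move=> x; apply: quat_ext; rewrite /= addNr. Qed.

HB.instance Definition _ :=
  GRing.isZmodule.Build (quaternion F) quat_addA quat_addC quat_add0 quat_addN.

Fact quat_mulA : associative quat_mul.
Proof. by move=> x y z; apply: quat_ext => /=; ring. Qed.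
Fact quat_mul1l : left_id quat_one quat_mul.
Proof. by move=> x; apply: quat_ext => /=; ring. Qed.
Fact quat_mul1r : right_id quat_one quat_mul.
Proof. by move=> x; apply: quat_ext => /=; ring. Qed.
Fact quat_mulDl : left_distributive quat_mul quat_add.
Proof. by move=> x y z; apply: quat_ext => /=; ring. Qed.
Fact quat_mulDr : right_distributive quat_mul quat_add.
Proof. by move=> x y z; apply: quat_ext => /=; ring. Qed.
Fact quat_one_neq0 : quat_one != 0.
Proof. by apply/eqP => -[] /eqP; rewrite oner_eq0. Qed.

HB.instance Definition _ :=
  GRing.Zmodule_isNzRing.Build (quaternion F)
    quat_mulA quat_mul1l quat_mul1r quat_mulDl quat_mulDr quat_one_neq0.

Definition quat_sqnorm x : F :=
  qre x ^+ 2 + qi x ^+ 2 + qj x ^+ 2 + qk x ^+ 2.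

(* Conjugate over squared norm; this sends 0 to 0. *)
Definition quat_inv x : quaternion F :=
  let n := quat_sqnorm x in
  Quat (qre x / n) (- qi x / n) (- qj x / n) (- qk x / n).

Lemma quat_sqnorm_eq0 x : (quat_sqnorm x == 0) = (x == 0).
Proof.
apply/eqP/eqP => [|->]; last by rewrite /quat_sqnorm /= expr0n /= !addr0.
case: x => a b c d; rewrite /quat_sqnorm /= => /eqP.
rewrite !paddr_eq0 ?addr_ge0 ?sqr_ge0 // !sqrf_eq0.
by move=> /andP[/andP[/andP[/eqP-> /eqP->] /eqP->] /eqP->].
Qed.

Fact quat_mulVx : {in [pred x | x != 0], left_inverse 1 quat_inv *%R}.
Proof.
move=> x; rewrite inE -quat_sqnorm_eq0 => nx.
by apply: quat_ext => /=; rewrite /quat_sqnorm in nx *; field.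
Qed.
Fact quat_mulxV : {in [pred x | x != 0], right_inverse 1 quat_inv *%R}.
Proof.
move=> x; rewrite inE -quat_sqnorm_eq0 => nx.
by apply: quat_ext => /=; rewrite /quat_sqnorm in nx *; field.
Qed.
Fact quat_unitP x y : y * x = 1 /\ x * y = 1 -> x != 0.
Proof.
move=> [_ xy1]; apply/eqP => x0; move: xy1; rewrite x0 mul0r => /esym/eqP.
by rewrite oner_eq0.
Qed.
Fact quat_inv_out : {in [predC [pred x | x != 0]], quat_inv =1 id}.
Proof.
move=> x; rewrite !inE negbK => /eqP->.
by apply: quat_ext => /=; rewrite ?oppr0 mul0r.
Qed.

HB.instance Definition _ :=
  GRing.NzRing_hasMulInverse.Build (quaternion F)
    quat_mulVx quat_mulxV quat_unitP quat_inv_out.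

Lemma quat_unitE x : (x \is a GRing.unit) = (x != 0).
Proof. by []. Qed.

Lemma hamilton_relations :
  let i : quaternion F := Quat 0 1 0 0 in
  let j : quaternion F := Quat 0 0 1 0 in
  let k : quaternion F := Quat 0 0 0 1 in
  [/\ i * i = -1, j * j = -1, k * k = -1 & i * j * k = -1].
Proof. by split; apply: quat_ext => /=; ring. Qed.

End Quaternions.

Record involutive_automorphism (H : nzRingType) (f : H -> H) : Prop :=
  InvolutiveAutomorphism {
    invol_aut_bij : bijective f;
    invol_aut_add : {morph f : x y / x + y};
    invol_aut_mul : {morph f : x y / x * y};
    invol_aut_invol : involutive f
  }.

(* The library's [unitmx] is restricted to commutative coefficient rings. *)
Definition nonsingular (H : nzRingType) (n : nat) (M : 'M[H]_n) : Prop :=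
  exists N : 'M[H]_n, M *m N = 1%:M /\ N *m M = 1%:M.

(* Main.v *)
(* If X = A X^ B + C, unitriangular S and R with corners X^ and X^ B do the job.
   Conversely, let M and N be the block matrices [A C; 0 I] and [A 0; 0 I], and
   D = diag(I, B).  Since the automorphism fixes the real center, the pairs
   (S, R) with M R = S^ N and D R = S D form a real vector space V, and those
   with M replaced by N form a space V0.  A nonsingular pair in V embeds V0
   into V, so dim V0 <= dim V.  The projection onto the bottom block rows sends
   V into the image of V0, and its kernels in V and in V0 coincide; so the
   images coincide too.  Hence V contains a pair with the same bottom rows as
   (I, I), and its top right corner S12 satisfies S12^ = A S12 B + C. *)
From HB Require Import structures.
Require Import Defs.
From mathcomp Require Import all_boot all_order all_algebra.
From mathcomp Require Import reals.
From mathcomp Require Import ring lra.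

Set Implicit Arguments.
Unset Strict Implicit.
Unset Printing Implicit Defensive.

Import Order.TTheory GRing.Theory Num.Theory.
Local Open Scope ring_scope.

(** * Real scalars as the center of the quaternions *)

Definition quat_real {F : realType} (a : F) : quaternion F := Quat a 0 0 0.

Section Center.
Variable F : realType.
Implicit Types (a b : F) (x : quaternion F).

Lemma quat_realD a b : quat_real (a + b) = quat_real a + quat_real b.
Proof. by apply: quat_ext; rewrite /= ?addr0. Qed.

Lemma quat_realM a b : quat_real (a * b) = quat_real a * quat_real b.
Proof. by apply: quat_ext => /=; ring. Qed.

Lemma quat_realC a x : quat_real a * x = x * quat_real a.
Proof. by apply: quat_ext => /=; ring. Qed.

Lemma quat_real_mulE a x :
  quat_real a * x = Quat (a * qre x) (a * qi x) (a * qj x) (a * qk x).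
Proof. by apply: quat_ext => /=; ring. Qed.

(** Commuting with i kills the j and k components, and commuting with j kills the i component. *)
Lemma quat_centralE x : (forall y, x * y = y * x) -> x = quat_real (qre x).
Proof.
move=> cx.
have /(congr1 (@qj F)) /= Ej := cx (Quat 0 1 0 0).
have /(congr1 (@qk F)) /= Ek := cx (Quat 0 1 0 0).
have /(congr1 (@qk F)) /= Ei := cx (Quat 0 0 1 0).
by apply: quat_ext => //=; lra.
Qed.

End Center.

(** * Involutive automorphisms and their entrywise action on matrices *)

Section InvolutiveAutomorphism.
Variables (F : realType) (hat : quaternion F -> quaternion F).
Hypothesis hat_aut : involutive_automorphism hat.

Let hatD : {morph hat : x y / x + y} := invol_aut_add hat_aut.
Let hatM : {morph hat : x y / x * y} := invol_aut_mul hat_aut.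
Let hatK : involutive hat := invol_aut_invol hat_aut.

Lemma invol_aut0 : hat 0 = 0.
Proof. by apply: (addrI (hat 0)); rewrite -hatD !addr0. Qed.

Lemma invol_aut1 : hat 1 = 1.
Proof. by rewrite -[LHS]mul1r -[X in X * _]hatK -hatM mulr1 hatK. Qed.

(* The automorphism induced on the real center preserves squares, hence is
   monotone, and a monotone involution of a total order is the identity. *)
Lemma invol_aut_real (a : F) : hat (quat_real a) = quat_real a.
Proof.
pose s b := qre (hat (quat_real b)).
have sE b : hat (quat_real b) = quat_real (s b).
  (* Every [y] is [hat (hat y)], so the image of a central element is central. *)
  by apply: quat_centralE => y; rewrite -[y]hatK -!hatM quat_realC.
have sK b : s (s b) = b by rewrite {1}/s -sE hatK.
have sD b c : s (b + c) = s b + s c by rewrite /s quat_realD hatD.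
have sM b c : s (b * c) = s b * s c.
  have := congr1 (@qre F) (sE (b * c)); rewrite quat_realM hatM !sE -quat_realM.
  by move=> /= <-.
have s_homo b c : b <= c -> s b <= s c.
  move=> lebc; rewrite -(subrK b c) sD lerDr -(sqr_sqrtr (_ : 0 <= c - b)).
    by rewrite expr2 sM -expr2 sqr_ge0.
  by rewrite subr_ge0.
rewrite sE; congr quat_real; apply: le_anti; apply/andP.
by case/orP: (le_total (s a) a) => le_sa; have := s_homo _ _ le_sa; rewrite sK.
Qed.

Lemma map_invol_autD p q (X Y : 'M_(p, q)) :
  map_mx hat (X + Y) = map_mx hat X + map_mx hat Y.
Proof. by apply/matrixP => i j; rewrite !mxE hatD. Qed.

Lemma map_invol_autM p q r (X : 'M_(p, q)) (Y : 'M_(q, r)) :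
  map_mx hat (X *m Y) = map_mx hat X *m map_mx hat Y.
Proof.
apply/matrixP => i j; rewrite !mxE (big_morph hat hatD invol_aut0).
by apply: eq_bigr => k _; rewrite hatM !mxE.
Qed.

Lemma map_invol_autZ p q a (X : 'M_(p, q)) :
  map_mx hat (quat_real a *: X) = quat_real a *: map_mx hat X.
Proof. by apply/matrixP => i j; rewrite !mxE hatM invol_aut_real. Qed.

Lemma map_invol_autK p q (X : 'M_(p, q)) : map_mx hat (map_mx hat X) = X.
Proof. by apply/matrixP => i j; rewrite !mxE hatK. Qed.

Lemma map_invol_aut0 p q : map_mx hat (0 : 'M_(p, q)) = 0.
Proof. by apply/matrixP => i j; rewrite !mxE invol_aut0. Qed.

Lemma map_invol_aut1 p : map_mx hat (1%:M : 'M_p) = 1%:M.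
Proof.
by apply/matrixP => i j; rewrite !mxE; case: eqP; rewrite ?invol_aut1 ?invol_aut0.
Qed.

End InvolutiveAutomorphism.

(* A copy of the matrix type carrying the real vector space structure, since
   quaternion matrices already are a left module over the quaternions. *)
Definition qmx (F : realType) (p : nat) := 'M[quaternion F]_p.

(** * Quaternion matrices as a finite-dimensional real vector space *)

Section RealStructure.
Variables (F : realType) (p : nat).

HB.instance Definition _ := GRing.Zmodule.on (qmx F p).

Definition qmx_scale (a : F) (X : qmx F p) : qmx F p := quat_real a *: X.

Fact qmx_scaleA a b X : qmx_scale a (qmx_scale b X) = qmx_scale (a * b) X.
Proof. by rewrite /qmx_scale scalerA quat_realM. Qed.
Fact qmx_scale1 : left_id 1 qmx_scale.
Proof. exact: scale1r. Qed.
Fact qmx_scaleDr : right_distributive qmx_scale +%R.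
Proof. by move=> a X Y; apply: scalerDr. Qed.
Fact qmx_scaleDl X : {morph qmx_scale^~ X : a b / a + b}.
Proof. by move=> a b; rewrite /qmx_scale quat_realD scalerDl. Qed.

HB.instance Definition _ := GRing.Zmodule_isLmodule.Build F (qmx F p)
  qmx_scaleA qmx_scale1 qmx_scaleDr qmx_scaleDl.

Lemma qmx_scaleE (a : F) (X : qmx F p) :
  a *: X = (quat_real a *: (X : 'M[quaternion F]_p)) :> 'M_p.
Proof. by []. Qed.

Lemma qmx_axiom : Vector.axiom (p * p + p * p + (p * p + p * p)) (qmx F p).
Proof.
pose coordinates (X : 'M[quaternion F]_p) : 'rV[F]_(_ + _ + (_ + _)) :=
  row_mx (row_mx (mxvec (map_mx (@qre F) X)) (mxvec (map_mx (@qi F) X)))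
         (row_mx (mxvec (map_mx (@qj F) X)) (mxvec (map_mx (@qk F) X))).
exists coordinates.
  move=> a X Y; rewrite /coordinates !scale_row_mx !add_row_mx -!linearP.
  by congr (row_mx (row_mx (mxvec _) (mxvec _)) (row_mx (mxvec _) (mxvec _)));
    apply/matrixP => i j; rewrite !mxE quat_real_mulE.
exists (fun v : 'rV_(_ + _ + (_ + _)) => (\matrix_(i, j)
  Quat (vec_mx (lsubmx (lsubmx v)) i j) (vec_mx (rsubmx (lsubmx v)) i j)
       (vec_mx (lsubmx (rsubmx v)) i j) (vec_mx (rsubmx (rsubmx v)) i j))).
  move=> X; apply/matrixP => i j.
  rewrite mxE /coordinates !(row_mxKl, row_mxKr) !mxvecK !mxE.
  by case: (X i j).
move=> v; rewrite /coordinates -[RHS]hsubmxK -[lsubmx v in RHS]hsubmxK.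
rewrite -[rsubmx v in RHS]hsubmxK.
congr (row_mx (row_mx _ _) (row_mx _ _));
  by rewrite -[RHS]vec_mxK; congr mxvec; apply/matrixP => i j; rewrite !mxE.
Qed.

HB.instance Definition _ := Lmodule_hasFinDim.Build F (qmx F p) qmx_axiom.

End RealStructure.

(** Real scalars are central, so left multiplication by a matrix is real-linear. *)
Lemma mulmx_scale_real (F : realType) p q r a (X : 'M[quaternion F]_(p, q))
    (Y : 'M_(q, r)) :
  X *m (quat_real a *: Y) = quat_real a *: (X *m Y).
Proof.
apply/matrixP => i j; rewrite !mxE mulr_sumr; apply: eq_bigr => k _.
by rewrite !mxE mulrA -quat_realC mulrA.
Qed.

(** By rank-nullity [p @: V] has dimension at least that of [p @: U], so the assumed inclusion of
    images is an equality. *)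
Lemma limg_subv_of_dim (K : fieldType) (E : vectType K) (p : 'End(E))
    (U V : {vspace E}) :
  (\dim U <= \dim V)%N -> (p @: V <= p @: U)%VS ->
  (V :&: lker p <= U :&: lker p)%VS -> (p @: U <= p @: V)%VS.
Proof.
move=> leUV pVU kVU.
suff /eqP -> : (p @: V == p @: U)%VS by [].
rewrite eqEdim pVU /=.
have := limg_ker_dim p U; have := limg_ker_dim p V; have := dimvS kVU.
move=> le_ker eV eU; rewrite -(leq_add2l (\dim (U :&: lker p))) eU.
by rewrite (leq_trans leUV) // -eV leq_add2r.
Qed.

(** * Solution pairs of the block equations and their dimension *)

Section Intertwiners.
Variables (F : realType) (hat : quaternion F -> quaternion F) (p : nat).
Hypothesis hat_aut : involutive_automorphism hat.
Implicit Types M N D Q S T : 'M[quaternion F]_p.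

(** Both equations are written as differences, so that the solution pairs form the kernel of a
    real-linear map. *)
Definition intertwining_defect M N D (SR : qmx F p * qmx F p) :
    qmx F p * qmx F p :=
  (M *m SR.2 - map_mx hat SR.1 *m N, D *m SR.2 - SR.1 *m D).

Fact intertwining_defect_linear M N D : linear (intertwining_defect M N D).
Proof.
move=> a [S T] [S' T']; rewrite /intertwining_defect /=.
congr pair; rewrite /= !qmx_scaleE !mulmxDr !mulmx_scale_real.
  rewrite (map_invol_autD hat_aut) (map_invol_autZ hat_aut) mulmxDl -scalemxAl.
  by rewrite scalerBr addrACA opprD.
by rewrite mulmxDl -scalemxAl scalerBr addrACA opprD.
Qed.
HB.instance Definition _ M N D := GRing.isLinear.Build F _ _ _
  (intertwining_defect M N D) (intertwining_defect_linear M N D).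

Definition intertwiners M N D : {vspace qmx F p * qmx F p} :=
  lker (linfun (intertwining_defect M N D)).

Lemma intertwinersP M N D S T :
  reflect (M *m T = map_mx hat S *m N /\ D *m T = S *m D)
          ((S : qmx F p, T : qmx F p) \in intertwiners M N D).
Proof.
rewrite /intertwiners memv_ker lfunE /= /intertwining_defect -pair_eqE /=.
rewrite !subr_eq0.
by apply: (iffP andP) => -[/eqP ? /eqP ?].
Qed.

Definition lmul_pair Q Q' (SR : qmx F p * qmx F p) : qmx F p * qmx F p :=
  (Q *m SR.1, Q' *m SR.2).

Fact lmul_pair_linear Q Q' : linear (lmul_pair Q Q').
Proof.
move=> a [S T] [S' T']; rewrite /lmul_pair /=.
by congr pair; rewrite /= !qmx_scaleE mulmxDr mulmx_scale_real.
Qed.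
HB.instance Definition _ Q Q' := GRing.isLinear.Build F _ _ _
  (lmul_pair Q Q') (lmul_pair_linear Q Q').

(** The map [(X, Y)] to [(S X, T Y)] is injective and lands among the solutions for [M], since
    [M T Y = S^ N Y = S^ X^ N]. *)
Lemma dim_intertwiners_le M N D S T :
  nonsingular S -> nonsingular T ->
  (S : qmx F p, T : qmx F p) \in intertwiners M N D ->
  (\dim (intertwiners N N D) <= \dim (intertwiners M N D))%N.
Proof.
move=> [S' [_ S'S]] [T' [_ T'T]] /intertwinersP[MT DT].
pose phi := linfun (lmul_pair S T).
have phiI : (intertwiners N N D :&: lker phi)%VS = 0%VS.
  apply/eqP; rewrite -subv0; apply/subvP => -[X Y].
  rewrite memv_cap => /andP[_]; rewrite memv_ker lfunE /= -pair_eqE /=.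
  move=> /andP[/eqP SX /eqP TY].
  by rewrite memv0 -[X]mul1mx -[Y]mul1mx -{1}S'S -T'T -!mulmxA SX TY !mulmx0.
rewrite -(limg_ker_dim phi) phiI dimv0 add0n; apply/dimvS/subvP.
move=> _ /memv_imgP[[X Y] /intertwinersP[NY DY] ->].
rewrite lfunE; apply/intertwinersP; split.
  by rewrite (map_invol_autM hat_aut) !mulmxA MT -!mulmxA NY.
by rewrite !mulmxA DT -!mulmxA DY.
Qed.

(* Flanders-Wimmer dimension count: left multiplication by a nonsingular
   solution embeds the solutions of the unperturbed system into those of the
   perturbed one; comparing their images and kernels under left multiplication
   by Q lifts [(Q, Q)], the image of the trivial solution, to the latter. *)
Lemma intertwiners_lift M N D Q S T :
  nonsingular S -> nonsingular T ->
  (S : qmx F p, T : qmx F p) \in intertwiners M N D ->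
  Q *m Q = Q -> map_mx hat Q = Q -> N *m Q = Q *m M -> D *m Q = Q *m D ->
  (M - N) *m Q = M - N ->
  exists S1 T1, [/\ (S1 : qmx F p, T1 : qmx F p) \in intertwiners M N D,
                   Q *m S1 = Q & Q *m T1 = Q].
Proof.
move=> uS uT ST QQ hatQ NQ DQ MNQ.
pose q := linfun (lmul_pair Q Q).
have le_img : (q @: intertwiners N N D <= q @: intertwiners M N D)%VS.
  apply: limg_subv_of_dim; first exact: dim_intertwiners_le uS uT ST.
    apply/subvP => _ /memv_imgP[[X Y] /intertwinersP[MY DY] ->].
    (* It now suffices that [(Q X, Q Y)] solves the unperturbed system:
       [N Q Y = Q M Y = Q X^ N = (Q X)^ N]. *)
    have -> : q (X, Y) = q (q (X, Y)).
      by rewrite !lfunE /= /lmul_pair /= !mulmxA QQ.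
    apply: memv_img; rewrite lfunE; apply/intertwinersP; split.
      by rewrite (map_invol_autM hat_aut) hatQ mulmxA NQ -!mulmxA MY.
    by rewrite mulmxA DQ -!mulmxA DY.
  (* If [Q Y = 0], then [(M - N) Y = (M - N) Q Y = 0], so [M Y = N Y]. *)
  apply/subvP => -[X Y]; rewrite !memv_cap => /andP[/intertwinersP[MY DY] qXY].
  rewrite qXY andbT; apply/intertwinersP; split => //; rewrite -MY.
  move: qXY; rewrite memv_ker lfunE /= -pair_eqE /= => /andP[_ /eqP QY].
  apply/esym/eqP; rewrite -subr_eq0 -mulmxBl -MNQ -mulmxA QY mulmx0.
  exact: eqxx.
have : q (1%:M : qmx F p, 1%:M : qmx F p) \in (q @: intertwiners N N D)%VS.
  apply: memv_img; apply/intertwinersP.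
  by rewrite (map_invol_aut1 hat_aut) !mulmx1 !mul1mx.
move=> /(subvP le_img) /memv_imgP[[S1 T1] ST1].
rewrite !lfunE /= /lmul_pair /= !mulmx1 => -[QS QT].
by exists S1, T1; split; rewrite -?QS -?QT.
Qed.

End Intertwiners.


Theorem theorem2 (F : realType) (hat : quaternion F -> quaternion F)
    (hat_aut : involutive_automorphism hat) (m n : nat)
    (A : 'M[quaternion F]_(m, m)) (B : 'M[quaternion F]_(n, n))
    (C : 'M[quaternion F]_(m, n)) :
  (exists X : 'M[quaternion F]_(m, n), X - A *m map_mx hat X *m B = C)
  <->
  (exists S R : 'M[quaternion F]_(m + n),
     [/\ nonsingular S, nonsingular R,
         block_mx A C 0 1%:M *m R = map_mx hat S *m block_mx A 0 0 1%:M
       & block_mx 1%:M 0 0 B *m R = S *m block_mx 1%:M 0 0 B]).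
Proof.
split=> [[X XC]|[S [R [uS uR MR DR]]]].
  have XE : X = A *m map_mx hat X *m B + C by rewrite -XC addrC subrK.
  have nonsingular_upper (Y : 'M[quaternion F]_(m, n)) :
      nonsingular (block_mx 1%:M Y 0 1%:M).
    exists (block_mx 1%:M (- Y) 0 1%:M).
    split; rewrite mulmx_block scalar_mx_block;
      by rewrite !(mulmx0, mul0mx, mulmx1, mul1mx, addr0, add0r) (addNr, subrr).
  exists (block_mx 1%:M (map_mx hat X) 0 1%:M).
  exists (block_mx 1%:M (map_mx hat X *m B) 0 1%:M); split => //.
    rewrite map_block_mx (map_invol_autK hat_aut).
    rewrite !(map_invol_aut1 hat_aut) (map_invol_aut0 hat_aut) !mulmx_block.
    rewrite !(mulmx0, mul0mx, mulmx1, mul1mx) !(addr0, add0r) mulmxA.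
    by rewrite -XE.
  by rewrite !mulmx_block !(mulmx0, mul0mx, mulmx1, mul1mx) !(addr0, add0r).
(* [Q] projects onto the bottom block rows; [M - N] lives in the right block column, hence absorbs
   [Q] on the right. *)
pose Q : 'M[quaternion F]_(m + n) := block_mx 0 0 0 1%:M.
pose M : 'M[quaternion F]_(m + n) := block_mx A C 0 1%:M.
pose N : 'M[quaternion F]_(m + n) := block_mx A 0 0 1%:M.
pose D : 'M[quaternion F]_(m + n) := block_mx 1%:M 0 0 B.
have blockE := (mulmx_block, mulmx0, mul0mx, mulmx1, mul1mx, addr0, add0r).
have QQ : Q *m Q = Q by rewrite /Q !blockE.
have hatQ : map_mx hat Q = Q.
  rewrite /Q map_block_mx (map_invol_aut1 hat_aut).
  by rewrite !(map_invol_aut0 hat_aut).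
have NQ : N *m Q = Q *m M by rewrite /N /Q !blockE.
have DQ : D *m Q = Q *m D by rewrite /D /Q !blockE.
have MNQ : (M - N) *m Q = M - N.
  by rewrite opp_block_mx add_block_mx !subrr oppr0 !blockE.
have SR : (S : qmx F (m + n), R : qmx F (m + n)) \in intertwiners hat M N D.
  exact/(intertwinersP hat_aut).
have [S1 [T1 [/(intertwinersP hat_aut)[MT DT] QS QT]]] :=
  intertwiners_lift hat_aut uS uR SR QQ hatQ NQ DQ MNQ.
(* The bottom right block of [T1] is the identity, so the top right blocks of the two equations read
   [A T12 + C = S12^] and [T12 = S12 B]; hence [X = S12^]. *)
move: QS QT MT DT; rewrite -[S1]submxK -[T1]submxK /Q map_block_mx.
rewrite !mulmx_block !(mulmx0, mul0mx, mulmx1, mul1mx) !(addr0, add0r).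
move=> /eq_block_mx[_ _ _ _] /eq_block_mx[_ _ _ ->] /eq_block_mx[_ MT _ _].
move=> /eq_block_mx[_ DT _ _]; exists (map_mx hat (ursubmx S1)).
by rewrite (map_invol_autK hat_aut) -MT DT mulmx1 mulmxA addrC addKr.
Qed.
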